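(* Let $G=[g_{ij}]\in\mathbb{R}^{N\times N}$ satisfy $g_{ii}=0$ for all $i$ and have spectral radius $\rho(G)<1$, let $\alpha\in\mathbb{R}^N$, let $B=\operatorname{diag}(b_1,\dots,b_N)$ with $b_i\in\{0,1\}$, and suppose the pair $(G,B)$ is controllable. Let $u_t=v_t/t^{\epsilon/2}$, where $v_t\sim\mathcal{N}(0,I)$ and $\epsilon\in[0,\frac{1}{N+1}]$ (the initial input $u_0\in\mathbb{R}^N$ being prescribed). Let $(x_t)$ be generated by $x_{t+1}=\alpha+Gx_t+Bu_t$, and let $x^\ast=(I-G)^{-1}\alpha$. Then $x_t\to x^\ast$ almost surely. Moreover, there exists an almost surely finite random variable $C_1(\omega)>0$ such that, for all sufficiently large $t$, $$\|x_t-x^\ast\|\le C_1(\omega)\left(\rho^t+\frac{\sqrt{\log t}}{t^{\epsilon/2}}\right),$$ where $\rho\in(0,1)$ is a constant.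
   Context: The pair $(G,B)$ is controllable if $\operatorname{rank}[B,\ GB,\ \dots,\ G^{N-1}B]=N$. The vector $x^\ast$, the unique solution of $(I-G)x^\ast=\alpha$, is the Nash equilibrium of the $N$-player linear-quadratic network game with payoffs $J_i(x_i,x_{-i})=\alpha_ix_i-\frac12x_i^2+\sum_{j\ne i}g_{ij}x_ix_j$. Here $x_t\in\mathbb{R}^N$ is the vector of player actions at time $t=0,1,\dots$, $G$ is the interaction matrix, $B$ is the probing selection matrix, $u_t\in\mathbb{R}^N$ is the probing input, and $\|\cdot\|$ is the Euclidean norm. The constant $\rho$ in the bound is a number in $(0,1)$, not the spectral radius function $\rho(\cdot)$.
   Formalization: The almost sure convergence of x_t to x* is stated only for ε > 0, since at ε = 0 it fails (controllability makes some b_i = 1, and that input coordinate stays N(0,1)); the rate bound is stated for all ε in [0, 1/(N+1)]. *)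

(* Defs.v *)
(* MathComp and MathComp-Analysis, over an arbitrary [R : realType]. *)
From HB Require Import structures.
From mathcomp Require Import all_boot all_order all_algebra.
From mathcomp Require Import complex.
From mathcomp Require Import all_classical all_reals all_analysis.
From mathcomp Require Import measurable_realfun.

Set Implicit Arguments.
Unset Strict Implicit.
Unset Printing Implicit Defensive.

Import Order.TTheory GRing.Theory Num.Theory.
Import numFieldNormedType.Exports.

Local Open Scope classical_set_scope.
Local Open Scope ring_scope.

(* The library norm [`|v|] on matrices is the sup norm. *)
Definition norm2 (R : realType) (N : nat) (v : 'cV[R]_N) : R :=
  Num.sqrt (\sum_(i < N) v i ord0 ^+ 2).

(* The eigenvalues are the complex ones.  The set of moduli is finite, so the
   supremum is a maximum; it is 0 when N = 0. *)
Definition spectral_radius (R : realType) (N : nat) (G : 'M[R]_N) : R :=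
  sup [set r : R | exists2 l : R[i],
    eigenvalue (map_mx (real_complex R) G) l & r = Normc.normc l].

Definition controllable (R : realType) (N : nat) (G B : 'M[R]_N) : Prop :=
  \rank (\mxrow_(k < N) (G ^+ k *m B)) = N.

Definition random_vector (R : realType) (d : measure_display)
    (T : measurableType d) (N : nat) (X : T -> 'cV[R]_N) : Prop :=
  forall i : 'I_N, measurable_fun [set: T] (fun w => X w i ord0).

(* X ~ N(0, I): the law of X is the N-fold product of N(0, 1), which is
   determined by its values on measurable boxes. *)
Definition standard_gaussian (R : realType) (d : measure_display)
    (T : measurableType d) (P : probability T R) (N : nat)
    (X : T -> 'cV[R]_N) : Prop :=
  random_vector X /\
  forall A : 'I_N -> set R, (forall i, measurable (A i)) ->
    P [set w | forall i, A i (X w i ord0)] =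
    (\prod_(i < N) normal_prob 0 1 (A i))%E.

(* At t = 0, where v_t / t^(eps/2) is meaningless, the input is u0. *)
Definition probing_input (R : realType) (T : Type) (N : nat) (eps : R)
    (u0 : 'cV[R]_N) (v : nat -> T -> 'cV[R]_N) (t : nat) (w : T) : 'cV[R]_N :=
  if t == 0%N then u0 else (t%:R `^ (eps / 2))^-1 *: v t w.

(* Main.v *)
Require Import Defs.
From HB Require Import structures.
From mathcomp Require Import all_boot all_order all_algebra.
From mathcomp Require Import complex.
From mathcomp Require Import all_classical all_reals all_analysis.
From mathcomp Require Import measurable_realfun.
From mathcomp Require Import ring lra zify.

Set Implicit Arguments.
Unset Strict Implicit.
Unset Printing Implicit Defensive.

Import Order.TTheory GRing.Theory Num.Theory.
Import numFieldNormedType.Exports.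

Local Open Scope classical_set_scope.
Local Open Scope ring_scope.

(** The error e_t = x_t - x* satisfies e_{t+1} = G e_t + B u_t, so
    e_t = G^(t-1) e_1 + sum_{1 <= s < t} G^(t-1-s) B u_s.  The theorem follows
    from a bound on the powers of G, an almost sure bound on the inputs, and a
    comparison of the resulting convolution with the rate of its last terms.

    Powers of G.  For every rho above the spectral radius the entries of G^n are
    O(rho^n) ([powers_entries_geometric]).  No norm adapted to G and no normal
    form is involved: over the complex numbers, Cayley-Hamilton writes 0 as a
    product of factors G - l with l an eigenvalue, and undoing one factor
    amounts to solving the scalar recurrence a_{n+1} = l a_n + O(rho^n) for each
    entry, with |l| < rho ([geometric_recurrence]).

    Inputs.  A standard normal Z has E exp(Z^2/4) < +oo, hence
    W = sum_t sum_i exp(v_{t,i}^2/4) / (t (t+1)) has a finite expectation and is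
    almost surely finite.  Each term is at most W, and taking logarithms gives
    v_{t,i}^2 <= 8 ln (t+1) + 4 W for all t and i at once
    ([gaussian_sqrt_log_growth]).  So W, which is measurable by construction,
    provides the random constant.

    Convolution.  For a in [0,1] and s < t one has
    s^(-a) <= 2 (t - s) t^(-a) ([inv_powR_shift_le]), so the polynomial decay of
    the input may be evaluated at the final time t at the price of a linear
    factor, which the geometric weights absorb since
    sum_k (k+1) rho^k = (1 - rho)^(-2).  This is [perturbed_iterates_rate].

    Convergence for eps > 0 then follows from the rate, as sqrt(ln t) is
    negligible against t^(eps/2). *)

(** * Geometric decay of matrix powers *)

Lemma normc_ge0 (R : realType) (z : R[i]) : 0 <= Normc.normc z.
Proof. by case: z => ? ?; exact: sqrtr_ge0. Qed.

(** The scalar recurrence left when one factor A - l of the characteristic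
    polynomial is removed.  The strict inequality r < rho excludes resonance,
    which would add a factor n; C / (rho - r) is the fixed point of
    M |-> (M r + C) / rho. *)
Lemma geometric_recurrence (R : realType) (r rho C : R) (l : R[i])
    (a b : nat -> R[i]) :
  Normc.normc l <= r -> r < rho ->
  (forall n, Normc.normc (b n) <= C * rho ^+ n) ->
  (forall n, a n.+1 = l * a n + b n) ->
  forall n, Normc.normc (a n) <= (Normc.normc (a 0%N) + C / (rho - r)) * rho ^+ n.
Proof.
move=> lr rrho bC aS; have r0 : 0 <= r := le_trans (normc_ge0 l) lr.
have rho0 : 0 < rho := le_lt_trans r0 rrho.
have d0 : 0 < rho - r by rewrite subr_gt0.
have C0 : 0 <= C by have := le_trans (normc_ge0 _) (bC 0%N); rewrite expr0 mulr1.
elim=> [|n IH]; first by rewrite expr0 mulr1 lerDl divr_ge0// ltW.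
rewrite aS (le_trans (le_normcD _ _))// Normc.normcM.
set M := _ + C / _ in IH *.
have MC : C <= M * (rho - r).
  by rewrite /M mulrDl divfK ?gt_eqF// lerDr mulr_ge0 ?normc_ge0// ltW.
have p0 : 0 <= rho ^+ n by rewrite exprn_ge0// ltW.
apply: (@le_trans _ _ (r * (M * rho ^+ n) + M * (rho - r) * rho ^+ n)).
  apply: lerD; first by apply: ler_pM; rewrite ?normc_ge0.
  by rewrite (le_trans (bC n))// ler_wpM2r.
by rewrite exprS le_eqVlt; apply/orP; left; apply/eqP; ring.
Qed.

(** With Q' = (A - l) Q one has A^(n+1) Q = l A^n Q + A^n Q', so the bound passes
    from Q' to Q entry by entry.  Carrying Q along makes the induction on the
    list of factors go through: it ends at the zero matrix. *)
Lemma entries_geometric_of_split_annihilator (R : realType) (m : nat)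
    (A : 'M[R[i]]_m) (r rho : R) (s : seq R[i]) (Q : 'M[R[i]]_m) :
  r < rho -> (forall l, l \in s -> Normc.normc l <= r) ->
  foldl (fun X l => (A - l%:M) *m X) Q s = 0 ->
  exists C : R, forall n i j, Normc.normc ((A ^+ n *m Q) i j) <= C * rho ^+ n.
Proof.
move=> rrho; elim: s Q => [|l s IH] Q /= hs.
  by move=> ->; exists 0 => n i j; rewrite mulmx0 mxE Normc.normc0 mul0r.
case/IH => [k ks|C HC]; first by rewrite hs// inE ks orbT.
have lr : Normc.normc l <= r by rewrite hs// mem_head.
pose c i j := Normc.normc (Q i j) + C / (rho - r).
have Hc i j n : Normc.normc ((A ^+ n *m Q) i j) <= c i j * rho ^+ n.
  have := @geometric_recurrence R r rho C l (fun n => (A ^+ n *m Q) i j)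
    (fun n => (A ^+ n *m ((A - l%:M) *m Q)) i j) lr rrho _ _ n.
  rewrite /= mul1mx; apply => // {}n.
  rewrite mulmxBl mul_scalar_mx exprSr -mulmxA mulmxBr -scalemxAr.
  have subE (U V : 'M[R[i]]_m) : (U - l *: V) i j = U i j - l * V i j.
    by rewrite !mxE.
  by rewrite subE subrKC.
have c0 i j : 0 <= c i j.
  by have := le_trans (normc_ge0 _) (Hc i j 0%N);
  rewrite expr0 mulr1.
have rho0 n : 0 <= rho ^+ n.
  by rewrite exprn_ge0// ltW// (le_lt_trans _ rrho)// (le_trans _ lr) ?normc_ge0.
(* A uniform constant: the sum of the entrywise ones. *)
exists (\sum_i \sum_j c i j) => n i j; rewrite (le_trans (Hc i j n))// ler_wpM2r//.
rewrite (bigD1 i)//= (bigD1 j)//= -addrA lerDl addr_ge0 ?sumr_ge0// => *.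
by rewrite sumr_ge0.
Qed.

Lemma foldl_char_factors (C : fieldType) (n : nat) (A : 'M[C]_n.+1) (s : seq C)
    (Q : 'M[C]_n.+1) :
  foldl (fun X l => (A - l%:M) *m X) Q s =
  horner_mx A (\prod_(z <- s) ('X - z%:P)) *m Q.
Proof.
elim: s Q => [|l s IH] Q /=; first by rewrite big_nil rmorph1 mul1mx.
rewrite IH big_cons mulrC rmorphM rmorphB /= horner_mx_X horner_mx_C.
by rewrite -mulmxA.
Qed.

(** The supremum is taken in R, where it is meaningful only for bounded sets: the
    eigenvalues are finitely many, being roots of the characteristic
    polynomial. *)
Lemma spectral_radius_ubound (R : realType) (N : nat) (G : 'M[R]_N) (l : R[i]) :
  eigenvalue (map_mx (real_complex R) G) l -> Normc.normc l <= spectral_radius G.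
Proof.
move=> ev; apply: ub_le_sup; last by exists l.
set A := map_mx _ _ in ev *.
have [s Hs] := closed_field_poly_normal (char_poly A).
exists (\sum_(z <- s) Normc.normc z) => _ [k ek ->].
have ks : k \in s.
  move: ek; rewrite eigenvalue_root_char Hs (monicP (char_poly_monic _)) scale1r.
  by rewrite root_prod_XsubC.
by rewrite (big_rem k)//= lerDl sumr_ge0// => z _; exact: normc_ge0.
Qed.

(** A pointwise weak form of Gelfand's formula, obtained from Cayley-Hamilton and
    the splitting of the characteristic polynomial over R[i]. *)
Lemma powers_entries_geometric (R : realType) (N : nat) (G : 'M[R]_N) (rho : R) :
  0 < rho -> spectral_radius G < rho ->
  exists2 C : R, 0 <= C & forall n i j, `|(G ^+ n) i j| <= C * rho ^+ n.
Proof.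
move=> rho0; case: N G => [|N] G Grho; first by exists 0 => // n [].
set A := map_mx (real_complex R) G.
have [s Hs] := closed_field_poly_normal (char_poly A).
rewrite (monicP (char_poly_monic _)) scale1r in Hs.
have [||C HC] := @entries_geometric_of_split_annihilator R N.+1 A _ rho s 1%:M Grho.
- move=> l ls; apply: spectral_radius_ubound.
  by rewrite eigenvalue_root_char Hs root_prod_XsubC.
- by rewrite foldl_char_factors -Hs Cayley_Hamilton mul0mx.
have GC n i j : `|(G ^+ n) i j| <= C * rho ^+ n.
  rewrite (le_trans _ (HC n i j))// mulmx1.
  have -> : A ^+ n = map_mx (real_complex R) (G ^+ n) by rewrite rmorphXn.
  by rewrite mxE /Normc.normc /= expr0n/= addr0 sqrtr_sqr.
exists C => //.
by have := le_trans (normr_ge0 _) (GC 0%N ord0 ord0); rewrite expr0 mulr1.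
Qed.

(** * Almost sure growth of standard Gaussian sequences *)

(** The Radon-Nikodym derivative of the normal law is the normal density almost
    everywhere, because both integrate to the law on every measurable set. *)
Lemma ge0_integral_normal_prob (R : realType) (m s : R) (f : R -> \bar R) :
  (forall y, (0 <= f y)%E) -> measurable_fun [set: R] f ->
  (\int[normal_prob m s]_y f y =
   \int[lebesgue_measure]_y (f y * (normal_pdf m s y)%:E))%E.
Proof.
move=> f0 mf; have dom := @normal_prob_dominates R m s.
rewrite -(Radon_Nikodym_SigmaFinite.change_of_variables dom)//.
have mpdf : measurable_fun [set: R] (fun y => (normal_pdf m s y)%:E).
  by apply: measurableT_comp => //; exact: measurable_normal_pdf.
apply: ae_eq_integral => //.
- apply: emeasurable_funM => //.
  exact: measurable_int (Radon_Nikodym_SigmaFinite.f_integrable dom).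
- exact: emeasurable_funM.
- apply: ae_eqe_mul2l; apply: integral_ae_eq => //.
  + exact: Radon_Nikodym_SigmaFinite.f_integrable.
  + by move=> E _ mE; rewrite -Radon_Nikodym_SigmaFinite.f_integral.
Qed.

(** The exponent 1/4, below the critical 1/2, leaves exp(-y^2/4): up to a constant
    this is the density of the normal law of variance 2, with total mass 1. *)
Lemma integral_expR_sqr_normal (R : realType) :
  (\int[normal_prob 0 1]_y (expR (y ^+ 2 / 4))%:E < +oo :> \bar R)%E.
Proof.
have mf : measurable_fun [set: R] (fun y : R => (expR (y ^+ 2 / 4))%:E).
  apply/measurable_EFinP/measurableT_comp => //.
  by apply: measurable_funM => //; exact: measurable_funX.
rewrite ge0_integral_normal_prob//.
have s0 : (Num.sqrt 2 : R) != 0 by rewrite gt_eqF// sqrtr_gt0.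
set c := @normal_peak R 1 / normal_peak (Num.sqrt 2).
have pdfE y : ((expR (y ^+ 2 / 4))%:E * (normal_pdf 0 1 y)%:E =
    c%:E * (normal_pdf 0 (Num.sqrt 2) y)%:E :> \bar R)%E.
  rewrite -!EFinM !normal_pdfE// /c !mulrA divfK ?gt_eqF ?normal_peak_gt0//.
  rewrite mulrC mulrA mulrC -!mulrA; congr (_ * _)%:E.
  rewrite /normal_fun subr0 -expRD sqr_sqrtr// expr1n; congr expR.
  by field.
under eq_integral do rewrite pdfE.
rewrite integralZl//=; last exact: integrable_normal_pdf.
by rewrite integral_normal_pdf mule1 ltry.
Qed.

(** The coordinate is isolated by the box whose other sides are the whole line. *)
Lemma standard_gaussian_coord (R : realType) (d : measure_display)
    (T : measurableType d) (P : probability T R) (N : nat) (X : T -> 'cV[R]_N)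
    (i : 'I_N) (A : set R) :
  standard_gaussian P X -> measurable A ->
  P [set w | A (X w i ord0)] = normal_prob 0 1 A.
Proof.
move=> [mX XA] mA.
have := XA (fun j => if j == i then A else setT) _.
rewrite (bigD1 i)//= eqxx big1 => [H|j /negPf ->]; last exact: probability_setT.
rewrite mule1 in H; rewrite -H; last by move=> j; case: ifP.
congr (P _); apply/seteqP; split => w /=.
  by move=> Aw j; case: eqP => // ->.
by move/(_ i); rewrite eqxx.
Qed.

Lemma standard_gaussian_exp_moment (R : realType) (d : measure_display)
    (T : measurableType d) (P : probability T R) (N : nat) (X : T -> 'cV[R]_N)
    (i : 'I_N) :
  standard_gaussian P X ->
  (\int[P]_w (expR (X w i ord0 ^+ 2 / 4))%:E =
   \int[normal_prob 0 1]_y (expR (y ^+ 2 / 4))%:E)%E.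
Proof.
move=> GX; have mX := GX.1 i.
have mf : measurable_fun [set: R] (fun y : R => (expR (y ^+ 2 / 4))%:E).
  apply/measurable_EFinP/measurableT_comp => //.
  by apply: measurable_funM => //; exact: measurable_funX.
(* Packing the coordinate as a measurable function makes its law a measure. *)
pose Y : {mfun T >-> measurableTypeR R} := HB.pack (fun w => X w i ord0)
  (isMeasurableFun.Build _ _ _ (measurableTypeR R) (fun w => X w i ord0) mX).
transitivity (\int[pushforward P Y]_y (expR (y ^+ 2 / 4))%:E)%E.
  by rewrite (@ge0_integral_pushforward _ _ _ (measurableTypeR R))//= preimage_setT.
by apply: eq_measure_integral => A mA _; exact: standard_gaussian_coord.
Qed.

(** The weights 1/((k+1)(k+2)) telescope; their logarithm is only O(ln k), which
    is what makes the almost sure bound below logarithmic. *)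
Lemma sum_inv_consecutive_le1 (R : realType) (n : nat) :
  \sum_(0 <= k < n) (k.+1 * k.+2)%:R^-1 <= 1 :> R.
Proof.
suff -> : \sum_(0 <= k < n) (k.+1 * k.+2)%:R^-1 = 1 - n.+1%:R^-1 :> R.
  by rewrite gerBl invr_ge0.
elim: n => [|n IH]; first by rewrite big_nil invr1 subrr.
rewrite big_nat_recr//= IH natrM -[n.+2%:R]natr1.
have n0 : n.+1%:R != 0 :> R by rewrite pnatr_eq0.
have n1 : n.+1%:R + 1 != 0 :> R by rewrite natr1 pnatr_eq0.
by field; rewrite [1 + _]addrC !natr1 !pnatr_eq0.
Qed.

(** A replacement for the Borel-Cantelli lemma: uniformly bounded expectations
    make the weighted sum integrable, hence almost surely finite, and the sum
    bounds all its terms by one measurable random variable. *)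
Lemma weighted_series_ae_lty (R : realType) (d : measure_display)
    (T : measurableType d) (P : probability T R) (f : nat -> T -> \bar R)
    (c : \bar R) :
  (forall n, measurable_fun [set: T] (f n)) -> (forall n w, (0 <= f n w)%E) ->
  (c < +oo)%E -> (forall n, \int[P]_w f n w <= c)%E ->
  {ae P, forall w,
    (\sum_(0 <= n <oo) ((n.+1 * n.+2)%:R^-1%:E * f n w) < +oo)%E}.
Proof.
move=> mf f0 coo intf; pose h n w := ((n.+1 * n.+2)%:R^-1%:E * f n w)%E.
pose W w := (\sum_(0 <= n <oo) h n w)%E.
have h0 n w : (0 <= h n w)%E by rewrite mule_ge0// lee_fin invr_ge0.
have mh n : measurable_fun [set: T] (h n) by exact: emeasurable_funM.
have mW : measurable_fun [set: T] W by apply: ge0_emeasurable_sum.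
have W0 w : (0 <= W w)%E by exact: nneseries_ge0.
have c0 : (0 <= c)%E by rewrite (le_trans _ (intf 0%N))// integral_ge0.
have intW : (\int[P]_w W w <= c)%E.
  rewrite integral_nneseries//; apply: lime_le.
    by apply: is_cvg_nneseries => n _ _; exact: integral_ge0.
  apply: nearW => n.
  apply: (@le_trans _ _ (\sum_(0 <= k < n) ((k.+1 * k.+2)%:R^-1%:E * c))%E).
    apply: lee_sum => k _; rewrite ge0_integralZl//.
    by rewrite lee_pmul2l// lte_fin invr_gt0 ltr0n.
  rewrite -ge0_sume_distrl; last by move=> k _; rewrite lee_fin invr_ge0.
  rewrite sumEFin -[leRHS]mul1e lee_wpmul2r// lee_fin.
  exact: sum_inv_consecutive_le1.
have iW : P.-integrable setT W.
  apply/integrableP; split => //.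
  by under eq_integral do rewrite gee0_abs//; exact: le_lt_trans coo.
apply: filterS (integrable_ae measurableT iW) => w /(_ I) Ww.
by move: Ww; rewrite -[X in (X < _)%E]/(W w) ltey_eq => ->.
Qed.

(** The extended-real variable M is an affine function of the weighted sum W of
    the exponential moments.  Writing the growth with ln (t+1) rather than ln t
    keeps it bounded below by ln 2 > 0, so that the additive term 4 W is absorbed
    in a multiple of the logarithm and t = 1 needs no special treatment. *)
Lemma gaussian_sqrt_log_growth (R : realType) (d : measure_display)
    (T : measurableType d) (P : probability T R) (N : nat)
    (v : nat -> T -> 'cV[R]_N) :
  (forall t : nat, (0 < t)%N -> standard_gaussian P (v t)) ->
  exists M : T -> \bar R, [/\ measurable_fun [set: T] M,
    (forall w, (0 <= M w)%E), {ae P, forall w, (M w < +oo)%E} &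
    forall w (t : nat) i r, M w = r%:E -> (0 < t)%N ->
      `|v t w i ord0| <= r * Num.sqrt (ln t.+1%:R)].
Proof.
move=> vG.
pose f n w := (\sum_(i < N) (expR (v n.+1 w i ord0 ^+ 2 / 4))%:E)%E.
pose W w := (\sum_(0 <= n <oo) ((n.+1 * n.+2)%:R^-1%:E * f n w))%E.
have e0 n i w : (0 <= (expR (v n.+1 w i ord0 ^+ 2 / 4))%:E)%E.
  by rewrite lee_fin expR_ge0.
have me n i : measurable_fun [set: T]
    (fun w => (expR (v n.+1 w i ord0 ^+ 2 / 4))%:E).
  apply/measurable_EFinP/measurableT_comp => //; apply: measurable_funM => //.
  by apply: measurable_funX; exact: (vG _ _).1.
have f0 n w : (0 <= f n w)%E by exact: sume_ge0.
have mf n : measurable_fun [set: T] (f n) by exact: emeasurable_sum.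
have h0 n w : (0 <= (n.+1 * n.+2)%:R^-1%:E * f n w)%E.
  by rewrite mule_ge0// lee_fin invr_ge0.
have mW : measurable_fun [set: T] W.
  by apply: ge0_emeasurable_sum => // n _; exact: emeasurable_funM.
have W0 w : (0 <= W w)%E by exact: nneseries_ge0.
have Woo : {ae P, forall w, (W w < +oo)%E}.
  apply: (@weighted_series_ae_lty _ _ _ _ _
    (\sum_(i < N) \int[normal_prob 0 1]_y (expR (y ^+ 2 / 4))%:E)%E) => //.
    by apply: lte_sum_pinfty => i _; exact: integral_expR_sqr_normal.
  move=> n; rewrite ge0_integral_sum//; apply: lee_sum => i _.
  by rewrite standard_gaussian_exp_moment//; exact: vG.
have l2 : 0 < ln 2 :> R by rewrite ln_gt0// ltr1n.
pose k := 4 / ln 2 : R.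
have k0 : 0 < k by rewrite divr_gt0.
exists (fun w => 8%:E + k%:E * W w)%E; split.
- by apply: emeasurable_funD => //; exact: emeasurable_funM.
- by move=> w; rewrite adde_ge0// mule_ge0// lee_fin ltW.
- by apply: filterS Woo => w Ww; rewrite lte_add_pinfty ?ltry//
    lte_mul_pinfty ?lee_fin ?ltW.
- move=> w [//|n] i r Mr _; rewrite /= in Mr *.
  have [x Wx] : exists x, W w = x%:E.
    move: Mr (W0 w); case: (W w) => [x|//|//] Mr _; first by exists x.
    by move: Mr; rewrite gt0_muley ?lte_fin.
  move: Mr; rewrite Wx -EFinM -EFinD => -[<-].
  set y := v n.+1 w i ord0.
  have x0 : 0 <= x by rewrite -lee_fin -Wx.
  have yx : expR (y ^+ 2 / 4) <= (n.+1 * n.+2)%:R * x.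
    rewrite -ler_pdivrMl ?ltr0n// -lee_fin -Wx EFinM.
    apply: (@le_trans _ _ ((n.+1 * n.+2)%:R^-1%:E * f n w)%E).
      rewrite lee_wpmul2l ?lee_fin ?invr_ge0// /f (bigD1 i)//= leeDl//.
      exact: sume_ge0.
    apply: le_trans (nneseries_lim_ge n.+1 (fun m _ _ => h0 m w)).
    by rewrite big_nat_recr//= leeDr// sume_ge0.
  have xgt0 : 0 < x.
    by rewrite -(@pmulr_rgt0 _ (n.+1 * n.+2)%:R) ?ltr0n//
      (lt_le_trans (expR_gt0 _) yx).
  set L := ln n.+2%:R.
  have L2 : ln 2 <= L by rewrite ler_ln ?posrE ?ltr0n// ler_nat.
  have L0 : 0 < L := lt_le_trans l2 L2.
  (* ln ((n+2)^2 x) with ln x <= x *)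
  have y2 : y ^+ 2 / 4 <= L *+ 2 + x.
    rewrite -[leLHS]expRK.
    apply: (@le_trans _ _ (ln (n.+2%:R ^+ 2 * x))).
      rewrite ler_ln ?posrE ?expR_gt0//; last by rewrite mulr_gt0// exprn_gt0// ltr0n.
      rewrite (le_trans yx)// ler_wpM2r// -natrX ler_nat expnS expn1.
      by rewrite leq_mul2r/=.
    rewrite lnM ?posrE ?exprn_gt0 ?ltr0n// lnXn ?ltr0n// lerD2l ltW//.
    exact: ln_sublinear.
  have kx0 : 0 <= k * x by rewrite mulr_ge0// ltW.
  rewrite -(@ler_pXn2r _ 2)// ?nnegrE ?mulr_ge0 ?sqrtr_ge0 ?addr_ge0//.
  rewrite real_normK ?num_real// exprMn sqr_sqrtr; last exact: ltW.
  (* 8 + k x >= 1, so it is at most its own square: this avoids a square root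
     in the definition of M. *)
  apply: (@le_trans _ _ ((8 + k * x) * L)); last first.
    by rewrite ler_wpM2r 1?ltW//; nra.
  have kL : 4 <= k * L by rewrite /k mulrAC ler_pdivlMr// ler_wpM2l.
  have : 4 * x <= k * x * L by rewrite mulrAC ler_wpM2r.
  move: y2; lra.
Qed.

(** * Linear systems with a slowly decaying input *)

Lemma sum_arith_geometric_le (R : realType) (rho : R) (n : nat) :
  0 <= rho -> rho < 1 ->
  \sum_(k < n) k.+1%:R * rho ^+ k <= (1 - rho) ^- 2.
Proof.
move=> rho0 rho1; have d0 : 0 < 1 - rho by rewrite subr_gt0.
rewrite -[leRHS]mul1r ler_pdivlMr ?exprn_gt0//.
have -> : (\sum_(k < n) k.+1%:R * rho ^+ k) * (1 - rho) ^+ 2 =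
    1 - rho ^+ n * (1 + n%:R * (1 - rho)).
  elim: n => [|n IH]; first by rewrite big_ord0 expr0; ring.
  by rewrite big_ord_recr/= mulrDl IH [rho ^+ n.+1]exprS -natr1; ring.
rewrite gerBl mulr_ge0 ?exprn_ge0// addr_ge0// mulr_ge0//; exact: ltW.
Qed.

(** Variation of constants at a fixed horizon t.  The input is allowed to be larger
    by a factor t - s at the earlier time s; the weight rho^(t-1-s) pays for it. *)
Lemma perturbed_linear_system_bound (R : realType) (N : nat) (G : 'M[R]_N)
    (rho K h : R) (e d : nat -> 'cV[R]_N) (t : nat) :
  0 <= rho -> rho < 1 -> 0 <= K -> 0 <= h ->
  (forall n i j, `|(G ^+ n) i j| <= K * rho ^+ n) ->
  (forall s, e s.+1 = G *m e s + d s) ->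
  (forall (s : nat) i, (s < t)%N -> `|d s i ord0| <= h * (t - s)%:R) ->
  forall i, `|e t i ord0| <=
    K * (\sum_j `|e 0%N j ord0|) * rho ^+ t + K * h * N%:R / (1 - rho) ^+ 2.
Proof.
move=> rho0 rho1 K0 h0 GK eS dh i.
have mulbound n (y : 'cV[R]_N) : `|(G ^+ n *m y) i ord0| <=
    K * rho ^+ n * \sum_j `|y j ord0|.
  rewrite mxE (le_trans (ler_norm_sum _ _ _))// mulr_sumr ler_sum// => j _.
  by rewrite normrM ler_wpM2r.
have -> : e t = G ^+ t *m e 0%N + \sum_(s < t) G ^+ (t - s.+1) *m d s.
  elim: t {dh} => [|t IH]; first by rewrite big_ord0 addr0 expr0 mul1mx.
  rewrite big_ord_recr/= subnn expr0 mul1mx addrA eS; congr (_ + _).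
  have GS n : G *m G ^+ n = G ^+ n.+1 by rewrite exprS.
  rewrite IH mulmxDr mulmxA GS; congr (_ + _).
  rewrite mulmx_sumr; apply: eq_bigr => s _.
  by rewrite mulmxA GS subSS subnSK.
rewrite mxE (le_trans (ler_normD _ _))// lerD//.
  by rewrite (le_trans (mulbound _ _))// mulrAC.
rewrite summxE (le_trans (ler_norm_sum _ _ _))//.
apply: (@le_trans _ _ (\sum_(s < t)
    K * h * N%:R * ((t - s.+1).+1%:R * rho ^+ (t - s.+1)))).
  apply: ler_sum => s _; rewrite (le_trans (mulbound _ _))//.
  apply: (@le_trans _ _ (K * rho ^+ (t - s.+1) * \sum_(j < N) h * (t - s)%:R)).
    rewrite ler_wpM2l ?mulr_ge0 ?exprn_ge0// ler_sum// => j _; exact: dh.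
  rewrite sumr_const card_ord -mulr_natr subnSK// le_eqVlt; apply/orP; left.
  by apply/eqP; ring.
rewrite -mulr_sumr ler_wpM2l ?mulr_ge0//.
(* Reversing time puts the sum in the form sum_k (k+1) rho^k. *)
rewrite (reindex_inj rev_ord_inj)/=.
rewrite (eq_bigr (fun s : 'I_t => s.+1%:R * rho ^+ s)).
  exact: sum_arith_geometric_le.
by move=> s _; have -> : (t - (t - s.+1).+1)%N = s by have := ltn_ord s; lia.
Qed.

(** (t/s)^a <= t/s = 1 + (t-s)/s <= 2 (t - s), the first step because t/s >= 1 and
    a <= 1. *)
Lemma inv_powR_shift_le (R : realType) (a : R) (s t : nat) :
  0 <= a -> a <= 1 -> (0 < s)%N -> (s < t)%N ->
  (s%:R `^ a)^-1 <= 2 * (t - s)%:R * (t%:R `^ a)^-1.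
Proof.
move=> a0 a1 s0 st.
have s0' : 0 < s%:R :> R by rewrite ltr0n.
have t0' : 0 < t%:R :> R by rewrite ltr0n (ltn_trans s0).
rewrite ler_pdivlMr ?powR_gt0// mulrC -powR_inv1 ?powR_ge0//.
rewrite powRAC powR_inv1 ?(ltW s0')// -powRM ?invr_ge0 ?(ltW s0') ?(ltW t0')//.
have ts : t%:R / s%:R <= 2 * (t - s)%:R :> R.
  rewrite ler_pdivrMr// -!natrM ler_nat; move: s0 st; clear; nia.
have : 1 <= t%:R / s%:R :> R by rewrite ler_pdivlMr// mul1r ler_nat ltnW.
move=> ts1; apply: le_trans ts.
by rewrite -[leRHS]powRr1 ?ler_powR// divr_ge0// ltW.
Qed.


Lemma norm2_le_sum (R : realType) (N : nat) (v : 'cV[R]_N) :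
  norm2 v <= \sum_(i < N) `|v i ord0|.
Proof.
have s0 : 0 <= \sum_(i < N) `|v i ord0| by exact: sumr_ge0.
rewrite -[leRHS]ger0_norm// -sqrtr_sqr /norm2 ler_wsqrtr// expr2 mulr_suml.
apply: ler_sum => i _; rewrite -[_ ^+ 2]real_normK ?num_real// expr2.
by rewrite ler_wpM2l// (bigD1 i)//= lerDl sumr_ge0.
Qed.

Lemma entry_le_norm2 (R : realType) (N : nat) (v : 'cV[R]_N) (i : 'I_N) :
  `|v i ord0| <= norm2 v.
Proof.
rewrite -sqrtr_sqr /norm2 ler_wsqrtr// (bigD1 i)//= lerDl sumr_ge0// => j _.
exact: sqr_ge0.
Qed.

(** The system is started at time 1, since the input at time 0 does not follow the
    decay; this costs the factor 1/rho in the constant.  For s < t the factor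
    sqrt(ln (s+1)) is at most sqrt(ln t). *)
Lemma perturbed_iterates_rate (R : realType) (N : nat) (G : 'M[R]_N)
    (rho K m a : R) (e d : nat -> 'cV[R]_N) :
  0 < rho -> rho < 1 -> 0 <= K -> 0 <= m -> 0 <= a -> a <= 1 ->
  (forall n i j, `|(G ^+ n) i j| <= K * rho ^+ n) ->
  (forall t, e t.+1 = G *m e t + d t) ->
  (forall t i, (0 < t)%N ->
     `|d t i ord0| <= m * Num.sqrt (ln t.+1%:R) / t%:R `^ a) ->
  forall t, (0 < t)%N -> norm2 (e t) <=
    (N%:R * K / rho * (\sum_j `|e 1%N j ord0|) +
     2 * N%:R ^+ 2 * K / (1 - rho) ^+ 2 * m) *
    (rho ^+ t + Num.sqrt (ln t%:R) / t%:R `^ a).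
Proof.
move=> rho0 rho1 K0 m0 a0 a1 GK eS db [//|t] _.
set S := \sum_j _; set phi := _ / _ `^ a.
have S0 : 0 <= S by exact: sumr_ge0.
have phi0 : 0 <= phi by rewrite divr_ge0 ?sqrtr_ge0 ?powR_ge0.
have h0 : 0 <= 2 * m * phi by rewrite !mulr_ge0.
have D0 : 0 < (1 - rho) ^+ 2 by rewrite exprn_gt0// subr_gt0.
have dh (s : nat) i : (s < t)%N ->
    `|d s.+1 i ord0| <= 2 * m * phi * (t - s)%:R.
  move=> st; apply: le_trans (db _ i (ltn0Sn s)) _.
  apply: (@le_trans _ _ (m * Num.sqrt (ln t.+1%:R) *
      (2 * (t.+1 - s.+1)%:R * (t.+1%:R `^ a)^-1))).
    apply: ler_pM; rewrite ?mulr_ge0 ?sqrtr_ge0 ?invr_ge0 ?powR_ge0//.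
      rewrite ler_wpM2l// ler_wsqrtr// ler_ln ?posrE ?ltr0n// ler_nat.
      by rewrite ltnS.
    by apply: inv_powR_shift_le.
  by rewrite subSS /phi le_eqVlt; apply/orP; left; apply/eqP; ring.
have eb i := perturbed_linear_system_bound (ltW rho0) rho1 K0 h0 GK
  (fun s => eS s.+1) dh i.
apply: le_trans (norm2_le_sum _) _; apply: le_trans (ler_sum _ (fun i _ => eb i)) _.
rewrite sumr_const card_ord -[X in X <= _]mulr_natl -/S.
set A := N%:R * K / rho * S; set B := 2 * _ * K / _ * m.
have A0 : 0 <= A by rewrite !mulr_ge0 ?invr_ge0// ltW.
have B0 : 0 <= B by rewrite !mulr_ge0 ?exprn_ge0 ?invr_ge0// ltW.
have -> : N%:R * (K * S * rho ^+ t + K * (2 * m * phi) * N%:R / (1 - rho) ^+ 2) =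
    A * rho ^+ t.+1 + B * phi.
  by rewrite /A /B [rho ^+ t.+1]exprS; field; rewrite (gt_eqF rho0) subr_eq0 gt_eqF.
rewrite mulrDl !mulrDr lerD// ?lerDl ?lerDr mulr_ge0// exprn_ge0// ltW//.
Qed.

(** From a ln n = ln (n^a) <= n^a the quotient is at most a^(-1/2) n^(-a/2). *)
Lemma sqrt_ln_over_powR_cvg0 (R : realType) (a : R) : 0 < a ->
  (fun n => Num.sqrt (ln n.+1%:R) / n.+1%:R `^ a) @ \oo --> (0 : R).
Proof.
move=> a0.
have n0 n : 0 < n.+1%:R :> R by rewrite ltr0n.
apply: (@squeeze_cvgr _ _ _ _ (fun=> 0)
  (fun n => Num.sqrt a^-1 * (n.+1%:R^-1) `^ (a / 2))).
- apply: nearW => n; rewrite divr_ge0 ?sqrtr_ge0 ?powR_ge0//=.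
  have ln_le : ln n.+1%:R <= a^-1 * n.+1%:R `^ a :> R.
    by rewrite ler_pdivlMl// -ln_powR ltW// ln_sublinear// powR_gt0.
  rewrite ler_pdivrMr ?powR_gt0//.
  apply: le_trans (ler_wsqrtr ln_le) _.
  rewrite sqrtrM ?invr_ge0 ?(ltW a0)// -mulrA ler_wpM2l ?sqrtr_ge0//.
  rewrite -powR12_sqrt ?powR_ge0// -powRrM -[n.+1%:R^-1]powR_inv1 ?(ltW (n0 _))//.
  rewrite -powRrM.
  rewrite -powRD ?(gt_eqF (n0 _)) ?implybT//.
  by rewrite le_eqVlt; apply/orP; left; apply/eqP; congr (_ `^ _); field.
- exact: cvg_cst.
- rewrite -[X in _ --> X](mulr0 (Num.sqrt a^-1)); apply: cvgMr.
  have /cvg_at_rightP H := @powR_cvg0 R (a / 2) (divr_gt0 a0 (ltr0n _ 2)).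
  apply: (H (fun n => n.+1%:R^-1)); split; last exact: cvg_harmonic.
  by move=> n; rewrite invr_gt0.
Qed.

(** The topology of matrices comes from the sup norm, which the Euclidean norm
    dominates. *)
Lemma cvg_of_norm2_le (R : realType) (N : nat) (y : nat -> 'cV[R]_N)
    (l : 'cV[R]_N) (phi : nat -> R) :
  (forall n, norm2 (y n - l) <= phi n) -> phi @ \oo --> (0 : R) ->
  y @ \oo --> l.
Proof.
move=> yl /cvgrPdist_le phi0; apply/cvgrPdist_le => eps eps0.
near=> n.
have : `|0 - phi n| <= eps by near: n; exact: phi0.
rewrite sub0r normrN => /(le_trans (ler_norm _)) pe.
rewrite distrC /Num.Def.normr/= mx_normrE; apply: bigmax_le; first exact: ltW.
move=> [i j] _ /=; rewrite [j]ord1 (le_trans (entry_le_norm2 _ _))//.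
exact: le_trans (yl n) pe.
Unshelve. all: by end_near. Qed.

(** A singular 1 - G would make 1 an eigenvalue of G. *)
Lemma spectral_radius_unitmx (R : realType) (N : nat) (G : 'M[R]_N) :
  spectral_radius G < 1 -> 1%:M - G \in unitmx.
Proof.
move=> G1; rewrite -row_free_unit -kermx_eq0.
have -> : kermx (1%:M - G) = 0; last by rewrite eqxx.
apply/eqP; apply: contraTT G1 => kG; rewrite -leNgt.
have -> : (1 : R) = Normc.normc (1 : R[i]) by rewrite Normc.normc1.
apply: spectral_radius_ubound.
rewrite -(rmorph1 (real_complex R)) eigenvalue_map /eigenvalue /eigenspace.
apply: contraNneq kG => kG; 
rewrite kermx_eq0 /row_free -opprB mxrank_opp -/(row_free _) -kermx_eq0.
exact/eqP.
Qed.

(** * Convergence of the probed best-response dynamics *)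

Theorem theorem3 (R : realType) (d : measure_display) (T : measurableType d)
    (P : probability T R) (N : nat)
    (G : 'M[R]_N) (alpha : 'cV[R]_N) (b : 'rV[R]_N)
    (eps : R) (u0 : 'cV[R]_N) (v x : nat -> T -> 'cV[R]_N)
    (G_diag : forall i : 'I_N, G i i = 0)
    (G_rho : spectral_radius G < 1)
    (b01 : forall i : 'I_N, b ord0 i = 0 \/ b ord0 i = 1)
    (GB_ctrl : controllable G (diag_mx b))
    (eps_ge0 : 0 <= eps) (eps_le : eps <= (N.+1%:R)^-1)
    (v_gauss : forall t : nat, (0 < t)%N -> standard_gaussian P (v t))
    (x0_rv : random_vector (x 0%N))
    (x_dyn : forall (t : nat) (w : T), x t.+1 w =
       alpha + G *m x t w + diag_mx b *m probing_input eps u0 v t w) :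
  let xstar := invmx (1%:M - G) *m alpha in
  (0 < eps -> {ae P, forall w, (fun t => x t w) @ \oo --> xstar}) /\
  exists rho : R, (0 < rho /\ rho < 1) /\
  exists C1 : T -> \bar R,
    [/\ measurable_fun [set: T] C1,
        (forall w, (0 < C1 w)%E),
        {ae P, forall w, (C1 w < +oo)%E} &
        exists t0 : nat, {ae P, forall w, forall t : nat, (t0 <= t)%N ->
          ((norm2 (x t w - xstar))%:E <=
           C1 w * (rho ^+ t + Num.sqrt (ln t%:R) / t%:R `^ (eps / 2))%:E)%E}].
Proof.
move=> xstar.
have uG := spectral_radius_unitmx G_rho.
have xstarE : xstar = alpha + G *m xstar.
  have : (1%:M - G) *m xstar = alpha by rewrite /xstar mulKVmx.
  by rewrite mulmxBl mul1mx => <-; rewrite subrK.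
(* Any number strictly between the spectral radius and 1; the maximum keeps rho
   positive without a lower bound on the spectral radius. *)
pose rho := (1 + Num.max 0 (spectral_radius G)) / 2.
have rhoP : [/\ 0 < rho, rho < 1 & spectral_radius G < rho].
  have m0 : 0 <= Num.max 0 (spectral_radius G) by rewrite le_max lexx.
  have ms : spectral_radius G <= Num.max 0 (spectral_radius G).
    by rewrite le_max lexx orbT.
  have m1 : Num.max 0 (spectral_radius G) < 1 by rewrite gt_max ltr01.
  by rewrite /rho; split; lra.
have [rho0 rho1 Grho] := rhoP.
have [K K0 GK] := powers_entries_geometric rho0 Grho.
have [M [mM M0 Moo vM]] := gaussian_sqrt_log_growth v_gauss.
pose a := eps / 2.
have a0 : 0 <= a by rewrite divr_ge0.
have a1 : a <= 1.
  have : eps <= 1 by rewrite (le_trans eps_le)// invf_le1 ?ltr0n// ler1n.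
  by rewrite /a; lra.
pose phi (t : nat) := rho ^+ t + Num.sqrt (ln t%:R) / t%:R `^ a.
pose E1 w := \sum_j `|(x 1%N w - xstar) j ord0|.
pose A := N%:R * K / rho.
pose B := 2 * N%:R ^+ 2 * K / (1 - rho) ^+ 2.
have A0 : 0 <= A by rewrite !mulr_ge0 ?invr_ge0// ltW.
have B0 : 0 <= B.
  by rewrite !mulr_ge0 ?exprn_ge0 ?invr_ge0 ?exprn_ge0 ?subr_ge0// ltW.
have E10 w : 0 <= E1 w by exact: sumr_ge0.
(* The summand 1 makes C1 positive. *)
pose C1 w := ((1 + A * E1 w)%:E + B%:E * M w)%E.
have C1fin w : (M w < +oo)%E -> exists2 m, 0 <= m &
    M w = m%:E /\ C1 w = (1 + A * E1 w + B * m)%:E.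
  move=> Mw; have := M0 w; rewrite /C1; case: (M w) Mw => [m|//|//] _.
  by rewrite lee_fin => m0; exists m.
have rate w (m : R) : 0 <= m -> M w = m%:E -> forall t : nat, (0 < t)%N ->
    norm2 (x t w - xstar) <= (1 + A * E1 w + B * m) * phi t.
  move=> m0 Mm t t0.
  have phi0 : 0 <= phi t.
    by rewrite addr_ge0 ?exprn_ge0 ?(ltW rho0)// divr_ge0 ?sqrtr_ge0 ?powR_ge0.
  apply: (@le_trans _ _ ((A * E1 w + B * m) * phi t)); last first.
    by rewrite ler_wpM2r// -addrA lerDr.
  apply: (@perturbed_iterates_rate R N G rho K m a (fun t => x t w - xstar)
    (fun t => diag_mx b *m probing_input eps u0 v t w)) => //.
  - move=> s; rewrite x_dyn addrAC; congr (_ + _).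
    by rewrite [X in _ - X = _]xstarE opprD addrACA subrr add0r mulmxBr.
  - move=> s i s0; rewrite mul_diag_mx mxE /probing_input gtn_eqF// mxE.
    apply: (@le_trans _ _ `|(s%:R `^ a)^-1 * v s w i ord0|).
      by case: (b01 i) => ->; rewrite ?mul0r ?normr0 ?mul1r.
    rewrite normrM mulrC [`|_^-1|]ger0_norm ?invr_ge0 ?powR_ge0//.
    rewrite ler_wpM2r ?invr_ge0 ?powR_ge0//.
    exact: vM.
split.
  move=> eps_gt0; apply: filterS Moo => w /C1fin[m m0 [Mm _]].
  (* The rate holds from t = 1 on, hence the shift by one. *)
  rewrite -(cvg_shiftS (fun t => x t w)).
  apply: (@cvg_of_norm2_le _ _ _ _ (fun n => (1 + A * E1 w + B * m) * phi n.+1)).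
    by move=> n; exact: rate.
  rewrite -[X in _ --> X](mulr0 (1 + A * E1 w + B * m)); apply: cvgMr.
  rewrite -[X in _ --> X](addr0 0); apply: cvgD.
    rewrite (cvg_shiftS (GRing.exp rho)); apply: cvg_expr.
    by rewrite ger0_norm// ltW.
  by apply: sqrt_ln_over_powR_cvg0; rewrite divr_gt0.
exists rho; split => //; exists C1; split.
- apply: emeasurable_funD; last exact: emeasurable_funM.
  apply/measurable_EFinP; apply: measurable_funD => //; apply: measurable_funM => //.
  apply: measurable_sum => j; apply: measurableT_comp => //.
  have x1E w : (x 1%N w - xstar) j ord0 = \sum_k G j k * x 0%N w k ord0 +
      (alpha + diag_mx b *m u0 - xstar) j ord0.
    rewrite x_dyn /probing_input eqxx [alpha + _]addrC -!addrA mxE.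
    by congr (_ + _); rewrite mxE.
  under eq_fun do rewrite x1E.
  apply: measurable_funD => //; apply: measurable_sum => k.
  by apply: measurable_funM => //; exact: x0_rv.
- move=> w; rewrite (@lt_le_trans _ _ 1%:E)// /C1 -[leLHS]adde0 leeD//.
    by rewrite lee_fin lerDl mulr_ge0.
  by rewrite mule_ge0.
- by apply: filterS Moo => w /C1fin[m _ [_ ->]]; rewrite ltry.
- exists 1%N; apply: filterS Moo => w /C1fin[m m0 [Mm ->]] t t0.
  by rewrite -EFinM lee_fin; exact: rate.
Qed.
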